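(* Let $\mu$ be a finite deficient topological measure on $X$, and let $\mathcal{R}=\mathcal{R}_\mu$ and $\mathcal{L}=\mathcal{L}_\mu$ be the associated functionals, considered on $C_0(X)$. (i) The functional $\mathcal{R}$ is a p-conic quasi-linear functional, and the functional $\mathcal{L}$ is an n-conic quasi-linear functional. (ii) The functional $\mathcal{R}$ is an r-functional, and $\mathcal{L}$ is an l-functional.
   Context: $X$ is a locally compact Hausdorff connected space; $\mathscr{O}(X),\mathscr{C}(X),\mathscr{K}(X)$ are the families of open, closed, compact subsets. $C_b(X)$, $C_0(X)$: real continuous functions that are bounded, respectively vanish at infinity; $C_0(X)=C(X)$ if $X$ is compact. A deficient topological measure on $X$ is $\nu:\mathscr{C}(X)\cup\mathscr{O}(X)\to[0,\infty]$ such that: $\nu(C\sqcup K)=\nu(C)+\nu(K)$ for disjoint $C,K\in\mathscr{K}(X)$; $\nu(U)=\sup\{\nu(C): C\subseteq U, C\in\mathscr{K}(X)\}$ for open $U$; $\nu(F)=\inf\{\nu(U): F\subseteq U\in\mathscr{O}(X)\}$ for closed $F$. It is finite if $\nu(X)<\infty$. For finite $\mu$ and $f\in C_b(X)$, let $L_1(t)=\mu(f^{-1}((-\infty,t)))$, $R_1(t)=\mu(f^{-1}((t,\infty)))$, and let $l$, $r$ be the Lebesgue–Stieltjes measures on $\mathbb{R}$ associated with the non-decreasing functions $L_1$ and $-R_1$. Then $\mathcal{L}_\mu(f)=\int_{\mathbb{R}}t\,dl(t)$ and $\mathcal{R}_\mu(f)=\int_{\mathbb{R}}t\,dr(t)$.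 For $f\in C_0(X)$ let $A^+(f)$ (resp. $A^-(f)$) be the set of functions $\phi\circ f$ with $\phi:\overline{f(X)}\to\mathbb{R}$ continuous and non-decreasing (resp. non-increasing), where additionally $\phi(0)=0$ is required if $X$ is not compact. A functional $\rho$ on $C_0(X)$ with values in $[-\infty,\infty]$ (attaining at most one of $\pm\infty$) and $|\rho(0)|<\infty$ is: - p-conic quasi-linear if: $fg=0$, $f,g\ge0$ imply $\rho(f+g)=\rho(f)+\rho(g)$; $0\le g\le f$ implies $\rho(g)\le\rho(f)$; for each $f$, if $g,h\in A^+(f)$, $a,b\ge0$, then $\rho(ag+bh)=a\rho(g)+b\rho(h)$; - n-conic quasi-linear if: $fg=0$, $f,g\le0$ imply $\rho(f+g)=\rho(f)+\rho(g)$; $f\le g\le0$ implies $\rho(f)\le\rho(g)$; for each $f$, if $g,h\in A^-(f)$, $a,b\ge0$, then $\rho(ag+bh)=a\rho(g)+b\rho(h)$; - an r-functional if: $\rho(af)=a\rho(f)$ for $a>0$; $0\le g\le f$ implies $\rho(g)\le\rho(f)$; $\rho(f+g)=\rho(f)+\rho(g)$ whenever $fg=0$ and either $f,g\ge0$ or $f\ge0,g\le0$; and, if $X$ is compact (so constants are in the domain), $\rho(f+c)=\rho(f)+\rho(c)$ for every constant $c$; - an l-functional if: $\rho(af)=a\rho(f)$ for $a>0$; $g\le f\le0$ implies $\rho(g)\le\rho(f)$; $\rho(f+g)=\rho(f)+\rho(g)$ whenever $fg=0$ and either $f,g\le0$ or $f\ge0,g\le0$; and, if $X$ is compact, $\rho(f+c)=\rho(f)+\rho(c)$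 for every constant $c$. *)

(* Defs.v *)
From HB Require Import structures.
From mathcomp Require Import all_boot all_order all_algebra.
From mathcomp Require Import all_classical all_reals all_analysis.
Set Implicit Arguments.
Unset Strict Implicit.
Unset Printing Implicit Defensive.
Import Order.TTheory GRing.Theory Num.Theory.
Import numFieldNormedType.Exports.

Local Open Scope classical_set_scope.
Local Open Scope ring_scope.

(* A set function on the open and the closed sets is represented by a function
   on all subsets of X; its values on the other subsets are never used. *)
Definition deficient_topological_measure (R : realType) (X : topologicalType)
    (nu : set X -> \bar R) : Prop :=
  [/\ forall A : set X, open A \/ closed A -> (0 <= nu A)%E,
      forall C K : set X, compact C -> compact K -> C `&` K = set0 ->
        nu (C `|` K) = (nu C + nu K)%E,
      forall U : set X, open U ->
        nu U = ereal_sup [set nu C | C in [set C | compact C /\ C `<=` U]]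
    & forall F : set X, closed F ->
        nu F = ereal_inf [set nu U | U in [set U | open U /\ F `<=` U]]].

Definition C0 (R : realType) (X : topologicalType) (f : X -> R) : Prop :=
  continuous f /\ forall e : R, 0 < e -> compact [set x | e <= `|f x|].

Definition right_limit (R : realType) (F : R -> R) (t : R) : R :=
  lim (F s @[s --> t^'+]).

Section right_limit_cumulative.
Context (R : realType) (F : R -> R) (ndF : {homo F : x y / x <= y}).

Let right_limit_cvg t : F s @[s --> t^'+] --> right_limit F t.
Proof.
apply/cvg_ex; eexists.
apply: (@nondecreasing_at_right_cvgr _ F t +oo%O) => //.
- by move=> x y _ _; exact: ndF.
- exists (F t) => _ [s /= + <-].
  by rewrite in_itv/= andbT => /ltW; exact: ndF.
Qed.

Let right_limit_ge t : F t <= right_limit F t.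
Proof.
rewrite /right_limit; apply: limr_ge; first exact: (right_limit_cvg (t := t)).
by near=> s; apply: ndF; apply: ltW; near: s; exact: nbhs_right_gt.
Unshelve. all: by end_near. Qed.

Let right_limit_le t s : t < s -> right_limit F t <= F s.
Proof.
move=> ts; rewrite /right_limit; apply: limr_le.
  exact: (right_limit_cvg (t := t)).
by near=> u; apply: ndF; apply: ltW; near: u; exact: nbhs_right_lt.
Unshelve. all: by end_near. Qed.

Lemma right_limit_nondecreasing : {homo right_limit F : x y / x <= y}.
Proof.
move=> x y; rewrite le_eqVlt => /predU1P[->//|xy].
exact: le_trans (right_limit_le xy) (right_limit_ge y).
Qed.

Lemma right_limit_right_continuous : right_continuous (right_limit F).
Proof.
move=> t; apply/cvgrPdist_le => e e0.
have /cvgrPdist_le/(_ _ e0)[d /= d0 Hd] := right_limit_cvg (t := t).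
near=> s; have ts : t < s by near: s; exact: nbhs_right_gt.
rewrite distrC ger0_norm ?subr_ge0 ?right_limit_nondecreasing ?(ltW ts)//.
suff [u su] : exists2 u, s < u & `|right_limit F t - F u| <= e.
  rewrite distrC ger0_norm; last first.
    by rewrite subr_ge0 right_limit_le// (lt_trans ts).
  by apply: le_trans; rewrite lerB// right_limit_le.
have sd : s < t + d by near: s; apply: nbhs_right_lt; rewrite ltrDl.
exists ((s + (t + d)) / 2); first by rewrite midf_lt.
apply: Hd => /=; last by rewrite (lt_trans ts)// midf_lt.
rewrite distrC gtr0_norm ?subr_gt0 ?(lt_trans ts) ?midf_lt//.
by rewrite ltrBlDl midf_lt.
Unshelve. all: by end_near. Qed.

(* The proof of monotonicity is an argument of this copy of right_limit F so
   that it can carry the cumulative structure. *)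
Definition right_limit_cumulative (_ : {homo F : x y / x <= y}) : R -> R :=
  right_limit F.
End right_limit_cumulative.

HB.instance Definition _ (R : realType) (F : R -> R)
    (ndF : {homo F : x y / x <= y}) :=
  isCumulative.Build R _ R (right_limit_cumulative ndF)
    (right_limit_nondecreasing ndF) (right_limit_right_continuous ndF).

(* The Lebesgue-Stieltjes measure of a non-decreasing F, which need not be
   one-sided continuous: ]a, b] gets the mass F(b+) - F(a+), so that [a, b[ gets
   F(b-) - F(a-). When F is not non-decreasing the value is junk (the zero
   measure). *)
Definition stieltjes_measure (R : realType) (F : R -> R) :
    {measure set (measurableTypeR R) -> \bar R} :=
  match pselect {homo F : x y / x <= y} with
  | left ndF => lebesgue_stieltjes_measure (right_limit_cumulative ndF)
  | right _ => mzero
  end.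

Section functionals.
Context (R : realType) (X : topologicalType).
Implicit Types (mu : set X -> \bar R) (f g h : X -> R)
  (rho : (X -> R) -> \bar R).

Definition L1 mu f (t : R) : R := fine (mu (f @^-1` `]-oo, t[)).
Definition R1 mu f (t : R) : R := fine (mu (f @^-1` `]t, +oo[)).

Definition calL mu f : \bar R :=
  \int[stieltjes_measure (L1 mu f)]_(t in setT) t%:E.
Definition calR mu f : \bar R :=
  \int[stieltjes_measure (fun t => - R1 mu f t)]_(t in setT) t%:E.

(* L1 and - R1 are non-decreasing in the intended setting, so the junk value of
   stieltjes_measure does not occur in calL and calR. *)
Lemma le_mu_open mu (U V : set X) : deficient_topological_measure mu ->
  open U -> open V -> U `<=` V -> (mu U <= mu V)%E.
Proof.
move=> [_ _ muU _] oU oV UV; rewrite (muU _ oU) (muU _ oV).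
apply: ereal_sup_le => _ [C [cC CU] <-]; exists C => //.
by split => //; exact: subset_trans UV.
Qed.

Lemma le_fine_mu_open mu (U V : set X) : deficient_topological_measure mu ->
  (mu setT < +oo)%E -> open U -> open V -> U `<=` V ->
  fine (mu U) <= fine (mu V).
Proof.
move=> dmu muT oU oV UV.
have fin (W : set X) : open W -> mu W \is a fin_num.
  move=> oW; rewrite ge0_fin_numE; last by case: dmu => + _ _ _; apply; left.
  by apply: le_lt_trans muT; apply: le_mu_open => //; exact: openT.
by apply: fine_le; rewrite ?fin//; exact: le_mu_open.
Qed.

Lemma L1_nondecreasing mu f : deficient_topological_measure mu ->
  (mu setT < +oo)%E -> continuous f -> {homo L1 mu f : s t / s <= t}.
Proof.
move=> dmu muT /continuousP cf s t st.
apply: le_fine_mu_open => //; [exact: cf|exact: cf|].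
by move=> x /=; rewrite !in_itv/= => /lt_le_trans; apply.
Qed.

Lemma opp_R1_nondecreasing mu f : deficient_topological_measure mu ->
  (mu setT < +oo)%E -> continuous f ->
  {homo (fun t => - R1 mu f t) : s t / s <= t}.
Proof.
move=> dmu muT /continuousP cf s t st; rewrite lerN2.
apply: le_fine_mu_open => //; [exact: cf|exact: cf|].
by move=> x /=; rewrite !in_itv/= !andbT; exact: le_lt_trans.
Qed.

Definition Aplus f : set (X -> R) :=
  [set g | exists phi : R -> R,
    [/\ {within closure (range f), continuous phi},
        {in closure (range f) &, {homo phi : x y / x <= y}},
        ~ compact [set: X] -> phi 0 = 0
      & g = phi \o f]].

Definition Aminus f : set (X -> R) :=
  [set g | exists phi : R -> R,
    [/\ {within closure (range f), continuous phi},
        {in closure (range f) &, {homo phi : x y /~ x <= y}},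
        ~ compact [set: X] -> phi 0 = 0
      & g = phi \o f]].

(* A functional on C0 is a function on all of X -> R of which only the values
   on C0 matter. *)
Definition C0_functional rho : Prop :=
  ((forall f, C0 f -> rho f != -oo%E) \/ (forall f, C0 f -> rho f != +oo%E)) /\
  (`|rho (cst 0%R)| < +oo)%E.

Definition fun_le f g : Prop := forall x, f x <= g x.

Definition p_conic_quasi_linear rho : Prop :=
  [/\ C0_functional rho,
      forall f g, C0 f -> C0 g -> f \* g = cst 0 ->
        fun_le (cst 0) f -> fun_le (cst 0) g ->
        rho (f \+ g) = (rho f + rho g)%E,
      forall f g, C0 f -> C0 g -> fun_le (cst 0) g -> fun_le g f ->
        (rho g <= rho f)%E
    & forall f, C0 f -> forall g h, Aplus f g -> Aplus f h ->
        forall a b : R, 0 <= a -> 0 <= b ->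
        rho ((a \*o g) \+ (b \*o h)) = (a%:E * rho g + b%:E * rho h)%E].

Definition n_conic_quasi_linear rho : Prop :=
  [/\ C0_functional rho,
      forall f g, C0 f -> C0 g -> f \* g = cst 0 ->
        fun_le f (cst 0) -> fun_le g (cst 0) ->
        rho (f \+ g) = (rho f + rho g)%E,
      forall f g, C0 f -> C0 g -> fun_le f g -> fun_le g (cst 0) ->
        (rho f <= rho g)%E
    & forall f, C0 f -> forall g h, Aminus f g -> Aminus f h ->
        forall a b : R, 0 <= a -> 0 <= b ->
        rho ((a \*o g) \+ (b \*o h)) = (a%:E * rho g + b%:E * rho h)%E].

Definition r_functional rho : Prop :=
  [/\ C0_functional rho,
      forall f, C0 f -> forall a : R, 0 < a -> rho (a \*o f) = (a%:E * rho f)%E,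
      forall f g, C0 f -> C0 g -> fun_le (cst 0) g -> fun_le g f ->
        (rho g <= rho f)%E,
      forall f g, C0 f -> C0 g -> f \* g = cst 0 ->
        (fun_le (cst 0) f /\ fun_le (cst 0) g) \/
        (fun_le (cst 0) f /\ fun_le g (cst 0)) ->
        rho (f \+ g) = (rho f + rho g)%E
    & compact [set: X] -> forall f, C0 f -> forall c : R,
        rho (f \+ cst c) = (rho f + rho (cst c))%E].

Definition l_functional rho : Prop :=
  [/\ C0_functional rho,
      forall f, C0 f -> forall a : R, 0 < a -> rho (a \*o f) = (a%:E * rho f)%E,
      forall f g, C0 f -> C0 g -> fun_le g f -> fun_le f (cst 0) ->
        (rho g <= rho f)%E,
      forall f g, C0 f -> C0 g -> f \* g = cst 0 ->
        (fun_le f (cst 0) /\ fun_le g (cst 0)) \/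
        (fun_le (cst 0) f /\ fun_le g (cst 0)) ->
        rho (f \+ g) = (rho f + rho g)%E
    & compact [set: X] -> forall f, C0 f -> forall c : R,
        rho (f \+ cst c) = (rho f + rho (cst c))%E].

End functionals.

(* Main.v *)
From HB Require Import structures.
Require Import Defs.
From mathcomp Require Import all_boot all_order all_algebra.
From mathcomp Require Import all_classical all_reals all_analysis.
From mathcomp Require Import measurable_realfun lra.
Import Order.TTheory GRing.Theory Num.Theory.
Import numFieldNormedType.Exports.
Local Open Scope classical_set_scope.
Local Open Scope ring_scope.

(** The values calR mu f and calL mu f are the first moments of the
    Lebesgue-Stieltjes measures r(f) and l(f), and a measure on the line with
    finite tails is determined by the masses of the rays ]c, +oo[. The whole
    proof rests on the computation of these masses (rdist_tail, ldist_tail):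
    inner regularity of mu by compact sets makes c |-> mu [f > c]
    right-continuous, so r(f) gives ]c, +oo[ the mass mu [f > c], and in the same
    way l(f) gives ]-oo, c[ the mass mu [f < c].

    Four consequences follow by comparing tails.

    If phi is continuous and non-decreasing on the line, then [phi > s] is an
    open ray, so r(phi \o f) is the image of r(f) under phi (rdist_comp), and
    calR mu (phi \o f) is the integral of phi against r(f). All members of the
    cone of f are thus integrated against the same measure, and additivity on
    the cone is the linearity of the integral (calR_Aplus). The functions phi
    given on the closure of the range of f extend to the line because that
    closure is an interval, X being connected (extend_from_closure_range).
    Homogeneity and translation by constants are special cases.

    If f g = 0 and f >= 0, the additivity of mu on disjoint open sets yields
    r(f + g) + r(0) = r(f) + r(g), whence calR_add_disjoint; this one identity
    covers g >= 0 and g <= 0.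

    If 0 <= g <= f, the tails of r(g) are at most those of r(f), and the
    layer-cake formula gives monotonicity (le_calR).

    Finally l(f) is the image of r(- f) under t |-> - t, so that calL mu f is
    minus calR mu (- f) (calL_opp), and each property of calL is the mirror image
    of one of calR. *)

Local Notation pushforward_measure :=
  measure_function_pushforward__canonical__measure_function_Measure.

(** * Measures on the line and their tails *)

Lemma bigcup_itvNny (R : realType) :
  \bigcup_(n : nat) `](- n%:R : R), +oo[%classic = setT.
Proof.
rewrite -subTset => x _; exists (Num.bound `|x|) => //=.
rewrite in_itv/= andbT ltrNl (le_lt_trans _ (archi_boundP (normr_ge0 x)))//.
by rewrite ler_normr lexx orbT.
Qed.

(** The rays ]c, +oo[ are stable under intersection and generate the Borel
    sets, so a measure with finite tails is determined by them. Every identity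
    between measures below is an instance. *)
Lemma eq_measure_tails (R : realType)
    (m1 m2 : {measure set (measurableTypeR R) -> \bar R}) :
  (forall c : R, m1 `]c, +oo[%classic = m2 `]c, +oo[%classic) ->
  (forall c : R, (m1 `]c, +oo[%classic < +oo)%E) ->
  forall A, measurable A -> m1 A = m2 A.
Proof.
move=> m12 fin1.
have setIG : setI_closed (@RGenOInfty.G R).
  move=> _ _ [x ->] [y ->]; exists (Num.max x y).
  by apply/seteqP; split=> z /=; rewrite !in_itv/= !andbT gt_max => /andP.
have Gn (n : nat) : RGenOInfty.G (`](- n%:R : R), +oo[%classic).
  by exists (- n%:R).
apply: (@measure_unique _ R (measurableTypeR R) _ _
  (@RGenOInfty.measurableE R) setIG Gn (bigcup_itvNny R) m1 m2) => //.
by move=> _ [x ->].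
Qed.

Lemma finite_total_fin_num_fun d (T : measurableType d) (R : realType)
    (m : {measure set T -> \bar R}) : (m setT < +oo)%E -> fin_num_fun m.
Proof.
move=> mT A mA; rewrite ge0_fin_numE ?measure_ge0//.
by apply: le_lt_trans mT; apply: le_measure; rewrite ?inE.
Qed.

(** Finiteness is known only as a hypothesis on the total mass; the hypothesis
    is an argument of this copy of m so that the copy can be a canonical finite
    measure, to which the Fubini-Tonelli theorem applies. *)
Definition finite_copy d (T : measurableType d) (R : realType)
  (m : {measure set T -> \bar R}) (_ : (m setT < +oo)%E) : set T -> \bar R := m.
Arguments finite_copy {d T R m}.

HB.instance Definition _ d (T : measurableType d) (R : realType)
    (m : {measure set T -> \bar R}) (mT : (m setT < +oo)%E) :=
  Measure.copy (finite_copy mT) m.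

HB.instance Definition _ d (T : measurableType d) (R : realType)
    (m : {measure set T -> \bar R}) (mT : (m setT < +oo)%E) :=
  Measure_isFinite.Build _ _ _ (finite_copy mT)
    (finite_total_fin_num_fun _ _ _ _ mT).

(** Layer-cake formula: max(0, t) is the Lebesgue measure of [0, t[, and the two
    integrations are exchanged by Tonelli. *)
Lemma integral_positive_part (R : realType)
    (m : {measure set (measurableTypeR R) -> \bar R}) :
  (m setT < +oo)%E ->
  (\int[m]_t (Num.max 0 t)%:E =
   \int[lebesgue_measure]_(s in `[0%R, +oo[) m `]s, +oo[%classic)%E.
Proof.
move=> mT; pose m' : {finite_measure set _ -> \bar R} := finite_copy mT.
have -> : (\int[m]_t (Num.max 0 t)%:E =
    \int[m']_t \int[lebesgue_measure]_s (\1_`[0%R, t[ s)%:E)%E.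
  apply: eq_integral => t _; rewrite integral_indic//= setIT.
  rewrite lebesgue_measure_itv/= lte_fin.
  by rewrite maxElt; case: ifPn; rewrite ?oppr0 ?adde0.
rewrite (fubini_tonelli
  (fun p : measurableTypeR R * measurableTypeR R =>
    (\1_`[0%R, p.1[ p.2)%:E))//=.
- rewrite [in RHS]integral_mkcond/=; apply: eq_integral => s _.
  rewrite patchE.
  case: ifPn => [/set_mem|/negP/(contra_not (@mem_set _ _ _))] /=;
    rewrite in_itv/= andbT => s0.
    rewrite -[in RHS](setIT `]s, +oo[%classic) -integral_indic//.
    apply: eq_integral => t _; rewrite !indicE.
    by congr (nat_of_bool _)%:R%:E; apply/idP/idP => /set_mem/=;
      rewrite in_itv/= ?s0 ?andbT => st; apply/mem_set;
      rewrite /= in_itv/= ?s0 ?andbT.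
  apply: integral0_eq => t _; rewrite indicE memNset//= in_itv/=.
  by case: (0 <= s) s0.
- apply/measurable_EFinP/measurable_indic => /=.
  rewrite [X in measurable X](_ : _ =
      (fun p : measurableTypeR R * measurableTypeR R => 0 <= p.2)
        @^-1` [set true] `&` (fun p => p.2 < p.1) @^-1` [set true]); last first.
    by apply/seteqP; split => p; rewrite /= in_itv/= => /andP.
  rewrite -[X in measurable (X `&` _)]setTI -[X in measurable (_ `&` X)]setTI.
  apply: measurableI.
  + exact: (@measurable_fun_ler _ _ R setT (cst 0) snd).
  + exact: (@measurable_fun_ltr _ _ R setT snd fst).
Qed.

(** Stochastic dominance: the layer-cake integrands are comparable. *)
Lemma le_integral_tails (R : realType)
    (m1 m2 : {measure set (measurableTypeR R) -> \bar R}) :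
  (m1 setT < +oo)%E -> (m2 setT < +oo)%E ->
  (forall c : R, m1 `]c, +oo[%classic <= m2 `]c, +oo[%classic)%E ->
  (\int[m1]_t (Num.max 0 t)%:E <= \int[m2]_t (Num.max 0 t)%:E)%E.
Proof.
move=> m1T m2T m12; rewrite !integral_positive_part//.
have mtail (m : {measure set (measurableTypeR R) -> \bar R}) :
    (m setT < +oo)%E ->
    measurable_fun (`[0%R, +oo[%classic : set (measurableTypeR R))
      (fun s : R => m `]s, +oo[%classic).
  move=> mT.
  have mfin := finite_total_fin_num_fun _ _ _ _ mT.
  apply: (eq_measurable_fun
    (fun s : measurableTypeR R => (fine (m `]s, +oo[%classic))%:E)).
    by move=> s _; rewrite fineK// mfin.
  apply/measurable_EFinP.
  apply: (@nonincreasing_measurable R `[0%R, +oo[%classic).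
    exact: measurable_itv.
  move=> s t st.
  apply: fine_le; rewrite ?mfin//; apply: le_measure; rewrite ?inE//.
  by move=> x /=; rewrite !in_itv/= !andbT; exact: le_lt_trans.
apply: ge0_le_integral => //; exact: mtail.
Qed.

(** * Lebesgue-Stieltjes measures of rays *)

Lemma right_limit_bounds (R : realType) (F : R -> R) (s t : R) :
  {homo F : x y / x <= y} -> s < t ->
  F s <= right_limit F s <= F t.
Proof.
move=> ndF st; have cvgF : F u @[u --> s^'+] --> right_limit F s.
  apply/cvg_ex; eexists.
  apply: (@nondecreasing_at_right_cvgr _ F s +oo%O) => //.
  - by move=> x y _ _; exact: ndF.
  - exists (F s) => _ [u /= + <-].
    by rewrite in_itv/= andbT => /ltW; exact: ndF.
apply/andP; split.
  apply: limr_ge; first exact: cvgF.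
  by near=> u; apply: ndF; apply: ltW; near: u; exact: nbhs_right_gt.
apply: limr_le; first exact: cvgF.
by near=> u; apply: ndF; apply: ltW; near: u; exact: nbhs_right_lt.
Unshelve. all: by end_near. Qed.

(** For a non-decreasing function, right-continuity at c needs only one witness
    on the right of c for each e. *)
Lemma right_limit_eq (R : realType) (F : R -> R) (c : R) :
  {homo F : x y / x <= y} ->
  (forall e, 0 < e -> exists2 s, c < s & F s <= F c + e) ->
  right_limit F c = F c.
Proof.
move=> ndF rc; apply/le_anti/andP; split.
  apply/ler_addgt0Pr => e /rc[s cs]; apply: le_trans.
  by case/andP: (right_limit_bounds _ _ _ _ ndF cs).
by case/andP: (right_limit_bounds _ _ c (c + 1) ndF ltac:(by rewrite ltrDl)).
Qed.

Lemma stieltjes_measure_itvoc (R : realType) (F : R -> R) (a b : R) :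
  {homo F : x y / x <= y} -> a <= b ->
  stieltjes_measure F `]a, b]%classic = (right_limit F b - right_limit F a)%:E.
Proof.
move=> ndF ab; rewrite /stieltjes_measure; case: pselect => [ndF'|//].
rewrite /= /lebesgue_stieltjes_measure /measure_extension/=.
by rewrite measurable_mu_extE/= ?wlength_itv_bnd//; exact: is_ocitv.
Qed.

Lemma measure_bigcup_le d (T : measurableType d) (R : realType)
    (m : {measure set T -> \bar R}) (A : (set T)^nat) (l : \bar R) :
  (forall n, measurable (A n)) -> nondecreasing_seq A ->
  (forall n, m (A n) <= l)%E -> (m (\bigcup_n A n) <= l)%E.
Proof.
move=> mA ndA mAl.
have cvgA : m \o A @ \oo --> m (\bigcup_n A n).
  by apply: nondecreasing_cvg_mu => //; exact: bigcupT_measurable.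
rewrite -(cvg_lim _ cvgA)//; apply: lime_le; last exact: nearW.
by apply/cvg_ex; exists (m (\bigcup_n A n)).
Qed.

(** F is eventually equal to l, so bounded intervals ]c, b] already carry the
    whole mass of the ray; right-continuity of F at c is what makes the open
    end contribute exactly F c. *)
Lemma stieltjes_measure_itvoy (R : realType) (F : R -> R) (l M c : R) :
  {homo F : x y / x <= y} -> (forall t, M <= t -> F t = l) ->
  (forall e, 0 < e -> exists2 s, c < s & F s <= F c + e) ->
  stieltjes_measure F `]c, +oo[%classic = (l - F c)%:E.
Proof.
move=> ndF FM rc; have Fl t : F t <= l.
  by rewrite -(FM (Num.max M t)) ?le_max ?lexx// ndF// le_max lexx orbT.
have rF t : right_limit F t <= l.
  by case/andP: (right_limit_bounds _ _ t (t + 1) ndF ltac:(by rewrite ltrDl))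
    => _ /le_trans; apply.
apply/le_anti/andP; split.
  rewrite itv_bndy_bigcup_BRight; apply: measure_bigcup_le => [n|m n mn|n].
  - exact: measurable_itv.
  - apply/subsetPset => x /=; rewrite !in_itv/= => /andP[-> /le_trans]; apply.
    by rewrite lerD2l ler_nat.
  - rewrite stieltjes_measure_itvoc// ?lerDl// lee_fin.
    by rewrite (right_limit_eq _ _ _ ndF rc) lerB.
pose b := Num.max c M; have cb : c <= b by rewrite le_max lexx.
have Mb : M <= b by rewrite le_max lexx orbT.
have Fb : right_limit F b = l.
  rewrite right_limit_eq// => [|e e0]; first exact: FM.
  exists (b + 1); first by rewrite ltrDl.
  by rewrite (FM b)// (FM (b + 1)) ?lerDl ?(ltW e0)// (le_trans Mb)// lerDl.
rewrite -(right_limit_eq _ _ _ ndF rc) -{1}Fb -stieltjes_measure_itvoc//.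
apply: le_measure; rewrite ?inE; [exact: measurable_itv|exact: measurable_itv|].
by move=> x /=; rewrite !in_itv/= => /andP[->].
Qed.

(** Here it is left-continuity at c that counts: the measure is built from right
    limits, and ]-oo, c[ is exhausted by intervals whose right ends stay below
    c, where these right limits are between values of F. *)
Lemma stieltjes_measure_itvNyo (R : realType) (F : R -> R) (l M c : R) :
  {homo F : x y / x <= y} -> (forall t, t <= M -> F t = l) ->
  (forall e, 0 < e -> exists2 s, s < c & F c <= F s + e) ->
  stieltjes_measure F `]-oo, c[%classic = (F c - l)%:E.
Proof.
move=> ndF FM lc; have Fl t : l <= F t.
  by rewrite -(FM (Num.min M t)) ?ge_min ?lexx// ndF// ge_min lexx orbT.
have rF t : l <= right_limit F t.
  by case/andP: (right_limit_bounds _ _ t (t + 1) ndF ltac:(by rewrite ltrDl))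
    => /(le_trans (Fl t)).
apply/le_anti/andP; split.
  have -> : `]-oo, c[%classic =
      \bigcup_n `](c - n.+1%:R), (c - n.+1%:R^-1)]%classic.
    apply/seteqP; split=> x /=; rewrite in_itv/=.
      (* n + 1 must exceed both c - x and its inverse *)
      move=> xc; have [n xcn] : exists n, (c - x)^-1 + (c - x) < n.+1%:R.
        exists (Num.truncn ((c - x)^-1 + (c - x))); exact: truncnS_gt.
      have cx : 0 < c - x by rewrite subr_gt0.
      exists n => //=; rewrite in_itv/=; apply/andP; split.
        by rewrite ltrBlDr -ltrBlDl (le_lt_trans _ xcn)// lerDr invr_ge0 ltW.
      rewrite lerBrDr -lerBrDl -[leRHS]invrK lef_pV2 ?posrE ?invr_gt0//.
      by rewrite (le_trans _ (ltW xcn))// lerDl ltW.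
    move=> [n _]; rewrite /= in_itv/= => /andP[_ /le_lt_trans]; apply.
    by rewrite ltrBlDr ltrDl invr_gt0.
  apply: measure_bigcup_le => [n|m n mn|n].
  - exact: measurable_itv.
  - apply/subsetPset => x /=; rewrite !in_itv/= => /andP[].
    move=> /(le_lt_trans _) -> /=.
      by move/le_trans; apply; rewrite lerB// lef_pV2 ?posrE ?ltr0n// ler_nat.
    by rewrite lerB// ler_nat.
  - rewrite stieltjes_measure_itvoc//; last first.
      by rewrite lerB// (@le_trans _ _ 1) ?invf_le1 ?ltr0n ?ler1n.
    rewrite lee_fin lerB//.
    have : c - n.+1%:R^-1 < c by rewrite ltrBlDr ltrDl invr_gt0.
    by case/(right_limit_bounds _ _ _ _ ndF)/andP.
apply/lee_addgt0Pr => e /lc[s sc Fcs].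
(* strictly below M, so that the right limit of F at a is l *)
pose a := Num.min (M - 1) s.
have as_ : a <= s by rewrite ge_min lexx orbT.
have aM : a < M by rewrite gt_min ltrBlDr ltrDl ltr01.
have Fa : right_limit F a = l.
  apply/le_anti; rewrite rF andbT.
  case/andP: (right_limit_bounds _ _ _ _ ndF aM) => _.
  by rewrite [X in _ <= X]FM.
apply: (@le_trans _ _ (right_limit F s - l + e)%:E).
  rewrite lee_fin addrAC lerD2r (le_trans Fcs)// lerD2r.
  by case/andP: (right_limit_bounds _ _ _ _ ndF sc).
rewrite EFinD leeD2r// -[in leLHS]Fa -stieltjes_measure_itvoc//.
apply: le_measure; rewrite ?inE; [exact: measurable_itv|exact: measurable_itv|].
by move=> x /=; rewrite !in_itv/= => /andP[_ /le_lt_trans]; apply.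
Qed.

(** * Continuous non-decreasing functions of a real variable *)

Section real_functions.
Context {R : realType}.

(** The set is an open up-set of the line: it cannot contain its infimum. *)
Lemma open_ray_gt (phi : R -> R) s :
  continuous phi -> {homo phi : x y / x <= y} ->
  [\/ phi @^-1` `]s, +oo[ = set0, phi @^-1` `]s, +oo[ = setT
    | exists c, phi @^-1` `]s, +oo[ = `]c, +oo[%classic].
Proof.
move=> cphi ndphi; set U := phi @^-1` _.
have oU : open U by move/continuousP : (cphi); apply; exact: interval_open.
have [U0|/set0P U0] := eqVneq U set0; first exact: Or31.
have [UT|UT] := eqVneq U setT; first exact: Or32.
apply: Or33; have [y nUy] : exists y, ~ U y.
  by apply/existsNP => h; move/eqP: UT; apply; apply/seteqP; split.
have upU x z : U x -> x <= z -> U z.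
  rewrite /U /= !in_itv/= !andbT => sx xz.
  by rewrite (lt_le_trans sx)// ndphi.
have lbU : lbound U y.
  by move=> x Ux; rewrite leNgt; apply/negP => xy; apply/nUy/(upU x)/ltW.
have infU : has_inf U by split=> //; exists y.
have nUinf : ~ U (inf U).
  move=> /oU /nbhs_ballP[e /= e0 eU].
  have : U (inf U - e / 2).
    apply: eU; rewrite /ball/= opprB addrCA subrr addr0 gtr0_norm ?divr_gt0//.
    by rewrite ltr_pdivrMr// ltr_pMr// ltr1n.
  move/(ge_inf infU.2); rewrite leNgt => /negP; apply.
  by rewrite ltrBlDr ltrDl divr_gt0.
exists (inf U); apply/seteqP; split=> x; rewrite /= in_itv/= andbT.
  move=> Ux; rewrite lt_neqAle (ge_inf infU.2)// andbT.
  by apply/eqP => xE; apply: nUinf; rewrite xE.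
move=> /(inf_lt U0)[z Uz /ltW zx]; exact: upU Uz zx.
Qed.

Lemma continuous_measurableTypeR (phi : R -> R) : continuous phi ->
  measurable_fun setT (phi : measurableTypeR R -> measurableTypeR R).
Proof. by move=> cphi; exact: continuous_measurable_fun. Qed.

Definition clamp (a b t : R) : R := Num.min b (Num.max a t).

Lemma clamp_continuous a b : continuous (clamp a b).
Proof.
move=> t; apply: (@continuous_min _ _ (cst b) (fun t => Num.max a t)).
  exact: cvg_cst.
by apply: (@continuous_max _ _ (cst a) id); [exact: cvg_cst|exact: cvg_id].
Qed.

Lemma clamp_nondecreasing a b : {homo clamp a b : x y / x <= y}.
Proof.
by move=> x y xy; rewrite /clamp le_min2// le_max2.
Qed.

Lemma clamp_id a b t : a <= t <= b -> clamp a b t = t.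
Proof. by move=> /andP[ta tb]; rewrite /clamp max_r// min_r. Qed.

Lemma clamp_bounds a b t : a <= b -> a <= clamp a b t <= b.
Proof.
by move=> ab; rewrite /clamp le_min ab le_max lexx/= ge_min lexx.
Qed.

Lemma closure_inf (A : set R) : has_inf A -> closure A (inf A).
Proof.
move=> infA B /nbhs_ballP[e /= e0 eB].
have [y Ay yA] := inf_adherent e0 infA.
exists y; split=> //; apply: eB; rewrite /ball/= distrC ger0_norm.
  by rewrite ltrBlDl.
by rewrite subr_ge0; apply: ge_inf => //; case: infA.
Qed.

End real_functions.

(** * Regularity and additivity on open sets *)

Section dtm.
Context (R : realType) (X : topologicalType) (mu : set X -> \bar R).
Hypothesis dmu : deficient_topological_measure mu.
Hypothesis finmu : (mu [set: X] < +oo)%E.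
Implicit Types (f g : X -> R) (U V : set X).

Lemma dtm_open_fin_num U : open U -> mu U \is a fin_num.
Proof.
move=> oU; rewrite ge0_fin_numE; last by case: dmu => + _ _ _; apply; left.
by apply: le_lt_trans finmu; apply: le_mu_open => //; exact: openT.
Qed.

Lemma dtm_compact_le_open (C U : set X) :
  compact C -> open U -> C `<=` U -> (mu C <= mu U)%E.
Proof.
move=> cC oU CU; case: dmu => _ _ /(_ U oU) -> _.
by apply: ereal_sup_ubound; exists C.
Qed.

Lemma dtm_set0 : mu set0 = 0%E.
Proof.
have fin0 := dtm_open_fin_num set0 open0.
case: dmu => _ /(_ set0 set0 compact0 compact0 (setI0 _)) + _ _.
rewrite setU0; move: fin0; case: (mu set0) => // r _ [] rr.
by congr (_%:E); lra.
Qed.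

Lemma dtm_open_approx U (e : R) : open U -> 0 < e ->
  exists2 C, compact C /\ C `<=` U & (mu U <= mu C + e%:E)%E.
Proof.
move=> oU e0; have finU := dtm_open_fin_num U oU.
have supE : mu U = ereal_sup [set mu C | C in [set C | compact C /\ C `<=` U]].
  by case: dmu => _ _ + _; apply.
have [_ [C [cC CU] <-] Ce] : exists2 x,
    [set mu C | C in [set C | compact C /\ C `<=` U]] x & (mu U - e%:E < x)%E.
  by rewrite supE; apply: ub_ereal_sup_adherent; rewrite -?supE.
by exists C => //; rewrite -leeBlDr// ltW.
Qed.

(** A compact subset C of the disjoint union splits into C minus V and C minus
    U, which are again compact; so additivity on compact sets passes to open
    sets. *)
Lemma dtm_openU U V : open U -> open V -> U `&` V = set0 ->
  mu (U `|` V) = (mu U + mu V)%E.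
Proof.
move=> oU oV UV; have oUV := openU oU oV.
apply/le_anti/andP; split.
  apply/lee_addgt0Pr => e e0.
  have [C [cC CUV] /le_trans] := dtm_open_approx _ e oUV e0; apply.
  rewrite leeD2r//.
  have -> : C = (C `&` ~` V) `|` (C `&` ~` U).
    by rewrite -setIUr -setCI setIC setIC [V `&` U]setIC UV setC0 setIT.
  have cCV : compact (C `&` ~` V).
    by apply: compact_closedI => //; exact: open_closedC.
  have cCU : compact (C `&` ~` U).
    by apply: compact_closedI => //; exact: open_closedC.
  have CVU0 : (C `&` ~` V) `&` (C `&` ~` U) = set0.
    by apply/seteqP; split=> // x [[Cx nVx] [_ nUx]]; case: (CUV _ Cx).
  case: dmu => _ /(_ _ _ cCV cCU CVU0) -> _ _.
  apply: leeD; apply: dtm_compact_le_open => // x [Cx nx];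
    by case: (CUV _ Cx).
apply/lee_addgt0Pr => e e0.
have e2 : 0 < e / 2 by rewrite divr_gt0.
have [C [cC CU] Ce] := dtm_open_approx _ _ oU e2.
have [D [cD DV] De] := dtm_open_approx _ _ oV e2.
apply: (le_trans (leeD Ce De)); rewrite addeACA -EFinD -splitr leeD2r//.
have CD0 : C `&` D = set0.
  by apply/seteqP; split=> // x [/CU Ux /DV Vx]; rewrite -UV.
case: dmu => _ /(_ _ _ cC cD CD0) <- _ _.
by apply: dtm_compact_le_open => //; [exact: compactU|exact: setUSS].
Qed.

(** * The right and left distributions of a bounded function *)

(** All results hold for these functions. The class contains C0 and, unlike C0,
    all the functions phi \o f that come up, constants included. *)
Definition bounded_continuous f :=
  continuous f /\ exists M, forall x, `|f x| <= M.

Lemma open_gt f c : continuous f -> open (f @^-1` `]c, +oo[).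
Proof. by move=> /continuousP; apply; exact: interval_open. Qed.

(** A compact set C inside [f > c] that almost exhausts it lies in [f > s] for
    some s > c, since f attains its minimum on C. *)
Lemma R1_right_continuous f c e : continuous f -> 0 < e ->
  exists2 s, c < s & R1 mu f c <= R1 mu f s + e.
Proof.
move=> cf e0; have [C [cC Cc] Ce] := dtm_open_approx _ _ (open_gt f c cf) e0.
suff [s cs Cs] : exists2 s, c < s & C `<=` f @^-1` `]s, +oo[.
  exists s => //; rewrite -lee_fin EFinD /R1 !fineK ?dtm_open_fin_num//;
    try exact: open_gt.
  by rewrite (le_trans Ce)// leeD2r// dtm_compact_le_open//; exact: open_gt.
have [->|/set0P C0] := eqVneq C set0; first by exists (c + 1); rewrite ?ltrDl.
have [x /set_mem Cx xmin] := compact_EVT_min C0 cC (continuous_subspaceT cf).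
have := Cc _ Cx; rewrite /= in_itv/= andbT => cx.
exists ((c + f x) / 2); first by rewrite midf_lt.
move=> y Cy; rewrite /= in_itv/= andbT.
by rewrite (lt_le_trans _ (xmin y (mem_set Cy)))// midf_lt.
Qed.

Lemma L1_oppE f t : L1 mu f t = R1 mu (\- f) (- t).
Proof.
rewrite /L1 /R1; congr (fine (mu _)); apply/seteqP; split=> x /=.
  by rewrite !in_itv/= andbT ltrN2.
by rewrite !in_itv/= andbT ltrN2.
Qed.

(** The measures r and l whose first moments are the values of calR and calL. *)
Definition rdist f := stieltjes_measure (fun t => - R1 mu f t).
Definition ldist f := stieltjes_measure (L1 mu f).

(** Nothing is lost in the passage to right limits, c |-> mu [f > c] being
    right-continuous. *)
Lemma rdist_tail f c : bounded_continuous f ->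
  rdist f `]c, +oo[%classic = mu (f @^-1` `]c, +oo[).
Proof.
move=> [cf [M fM]]; rewrite /rdist (stieltjes_measure_itvoy _ _ 0 M).
- by rewrite sub0r opprK fineK// dtm_open_fin_num//; exact: open_gt.
- exact: opp_R1_nondecreasing.
- move=> t Mt; rewrite /R1 (_ : _ @^-1` _ = set0) ?dtm_set0 ?oppr0//.
  apply/seteqP; split=> // x /=; rewrite in_itv/= andbT ltNge.
  by rewrite (le_trans (ler_norm _))// (le_trans (fM x)).
- move=> e e0; have [s cs ce] := R1_right_continuous f c e cf e0.
  by exists s => //; lra.
Qed.

Lemma bounded_continuousN f : bounded_continuous f -> bounded_continuous (\- f).
Proof.
move=> [cf [M fM]]; split; first by move=> x; apply: cvgN; exact: cf.
by exists M => x /=; rewrite normrN.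
Qed.

Lemma ldist_tail f c : bounded_continuous f ->
  ldist f `]-oo, c[%classic = mu (f @^-1` `]-oo, c[).
Proof.
move=> bf; have [cNf [M fM]] := bounded_continuousN _ bf.
have [cf _] := bf.
rewrite /ldist (stieltjes_measure_itvNyo _ _ 0 (- M)).
- rewrite subr0 fineK// dtm_open_fin_num//.
  by move/continuousP : cf; apply; exact: interval_open.
- exact: L1_nondecreasing.
- move=> t Mt; rewrite L1_oppE /R1 (_ : _ @^-1` _ = set0) ?dtm_set0//.
  apply/seteqP; split=> // x /=; rewrite in_itv/= andbT ltNge.
  rewrite (le_trans (ler_norm _))// (le_trans (fM x))//; lra.
- move=> e e0; have [s cs ce] := R1_right_continuous _ (- c) e cNf e0.
  by exists (- s); rewrite ?L1_oppE ?opprK// ltrNl.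
Qed.

Lemma rdist_setT f : bounded_continuous f -> rdist f setT = mu setT.
Proof.
move=> bf; have [cf [M fM]] := bf; apply/le_anti/andP; split.
  rewrite -bigcup_itvNny.
  apply: measure_bigcup_le => [n|m n mn|n]; first exact: measurable_itv.
    apply/subsetPset => x /=; rewrite !in_itv/= !andbT; apply: le_lt_trans.
    by rewrite lerN2 ler_nat.
  rewrite rdist_tail//; apply: le_mu_open => //; [exact: open_gt|].
  exact: openT.
have <- : f @^-1` `](- M - 1), +oo[ = setT.
  apply/seteqP; split=> // x _ /=; rewrite in_itv/= andbT.
  by have := fM x; rewrite ler_norml => /andP[+ _]; apply: lt_le_trans; lra.
by rewrite -rdist_tail//; apply: le_measure; rewrite ?inE.
Qed.

Lemma rdist_setT_lty f : bounded_continuous f -> (rdist f setT < +oo)%E.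
Proof. by move=> bf; rewrite rdist_setT. Qed.

(** * Change of variables *)

Lemma bounded_continuous_comp f (phi : R -> R) : bounded_continuous f ->
  continuous phi -> {homo phi : x y / x <= y} ->
  bounded_continuous (phi \o f).
Proof.
move=> [cf [M fM]] cphi ndphi; split.
  by move=> x; apply: continuous_comp; [exact: cf|exact: cphi].
exists (`|phi (- M)| + `|phi M|) => x /=.
have /andP[lo hi] : phi (- M) <= phi (f x) <= phi M.
  by have := fM x; rewrite ler_norml => /andP[? ?]; rewrite !ndphi.
rewrite ler_norml; have := ler_norm (phi M); have := ler_norm (- phi (- M)).
rewrite normrN; have := normr_ge0 (phi M); have := normr_ge0 (phi (- M)).
by move=> *; apply/andP; split; lra.
Qed.

(** The set [phi > s] is empty, the whole line, or a ray ]c, +oo[; in each case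
    its r-mass is the mu-measure of [phi \o f > s]. *)
Lemma rdist_comp f (phi : R -> R) (A : set (measurableTypeR R)) :
  bounded_continuous f -> continuous phi -> {homo phi : x y / x <= y} ->
  measurable A ->
  rdist (phi \o f) A =
    pushforward (T2 := measurableTypeR R) (rdist f) phi A.
Proof.
move=> bf cphi ndphi mA; have mphi := continuous_measurableTypeR _ cphi.
have bpf := bounded_continuous_comp _ _ bf cphi ndphi.
apply: (eq_measure_tails _ (rdist (phi \o f))
  (pushforward_measure (rdist f) mphi)) => //= c; last first.
  apply: le_lt_trans (rdist_setT_lty _ bpf).
  by apply: le_measure; rewrite ?inE.
rewrite rdist_tail// /pushforward comp_preimage.
have [->|->|[d ->]] := open_ray_gt phi c cphi ndphi.
- by rewrite preimage_set0 measure0 dtm_set0.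
- by rewrite !preimage_setT rdist_setT.
- by rewrite rdist_tail.
Qed.

Lemma integrable_rdist f (phi : R -> R) M : bounded_continuous f ->
  continuous phi -> (forall t, `|phi t| <= M) ->
  (rdist f).-integrable setT (fun t : measurableTypeR R => (phi t)%:E).
Proof.
move=> bf cphi phiM.
apply: (@measurable_bounded_integrable _ (measurableTypeR R) R (rdist f) phi
  setT measurableT).
- exact: rdist_setT_lty.
- exact: continuous_measurable_fun.
- exists M; split; first exact: num_real.
  by move=> N MN x _; exact: le_trans (ltW MN).
Qed.

Lemma calR_comp f (phi : R -> R) M : bounded_continuous f ->
  continuous phi -> {homo phi : x y / x <= y} -> (forall t, `|phi t| <= M) ->
  calR mu (phi \o f) = (\int[rdist f]_t (phi t)%:E)%E.
Proof.
move=> bf cphi ndphi phiM; have mphi := continuous_measurableTypeR _ cphi.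
rewrite /calR -/(rdist (phi \o f)).
rewrite (eq_measure_integral
  (pushforward_measure (rdist f) mphi)); last first.
  by move=> A mA _ /=; exact: rdist_comp.
rewrite integral_pushforward//.
by rewrite preimage_setT; apply: integrable_rdist phiM.
Qed.

(** As f takes its values in [0, M], its distribution is its own image under the
    clamping to this interval, hence does not charge the negative half-line. *)
Lemma calR_ge0 f : bounded_continuous f -> (forall x, 0 <= f x) ->
  calR mu f = (\int[rdist f]_t (Num.max 0 t)%:E)%E.
Proof.
move=> bf f0; have [_ [M fM]] := bf; pose phi := clamp 0 `|M|.
have cphi : continuous phi by exact: clamp_continuous.
have ndphi : {homo phi : x y / x <= y} by exact: clamp_nondecreasing.
have phi0M t : 0 <= phi t <= `|M| by exact: clamp_bounds.
have mphi := continuous_measurableTypeR _ cphi.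
have phif : phi \o f = f.
  apply/funext => x /=; rewrite /phi clamp_id// f0/=.
  by rewrite (le_trans (ler_norm _))// (le_trans (fM x))// ler_norm.
rewrite -{1}phif (calR_comp _ _ `|M|)//; last first.
  by move=> t; have /andP[p0 pM] := phi0M t; rewrite ger0_norm.
rewrite [RHS](eq_measure_integral
  (pushforward_measure (rdist f) mphi)); last first.
  by move=> A mA _ /=; rewrite -[in LHS]phif; exact: rdist_comp.
rewrite [RHS]ge0_integral_pushforward//.
- rewrite preimage_setT; apply: eq_integral => t _ /=.
  by rewrite max_r//; case/andP: (phi0M t).
- apply/measurable_EFinP; exact: (@measurable_maxr _ _ R setT (cst 0) id).
- by move=> t _; rewrite lee_fin le_max lexx.
Qed.

(** * Monotonicity and disjoint additivity of calR *)

Lemma le_calR f g : bounded_continuous f -> bounded_continuous g ->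
  (forall x, 0 <= g x) -> (forall x, g x <= f x) -> (calR mu g <= calR mu f)%E.
Proof.
move=> bf bg g0 gf; rewrite !calR_ge0//; last first.
  by move=> x; apply: le_trans (gf x).
apply: le_integral_tails => [||c]; [exact: rdist_setT_lty..|].
rewrite !rdist_tail//; apply: le_mu_open => //; [|exact: open_gt bf.1|].
  exact: open_gt bg.1.
by move=> x /=; rewrite !in_itv/= !andbT => /lt_le_trans; apply.
Qed.

(** As f takes its values in [-M, M], its distribution is its own image under
    the clamping to this interval, and the clamping is bounded. *)
Lemma integrable_rdist_id f : bounded_continuous f ->
  (rdist f).-integrable setT (fun t : measurableTypeR R => t%:E).
Proof.
move=> bf; have [_ [M fM]] := bf; pose phi := clamp (- `|M|) `|M|.
have cphi : continuous phi by exact: clamp_continuous.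
have ndphi : {homo phi : x y / x <= y} by exact: clamp_nondecreasing.
have phiM t : `|phi t| <= `|M|.
  rewrite ler_norml clamp_bounds// lerNl.
  by rewrite (le_trans _ (normr_ge0 M))// oppr_le0.
have mphi := continuous_measurableTypeR _ cphi.
have phif : phi \o f = f.
  apply/funext => x /=; rewrite /phi clamp_id// -ler_norml.
  by rewrite (le_trans (fM x))// ler_norm.
have mid : measurable_fun setT (fun t : measurableTypeR R => t%:E).
  exact/measurable_EFinP/measurable_id.
have : (pushforward (T2 := measurableTypeR R) (rdist f) phi).-integrable setT
    (fun t : measurableTypeR R => t%:E).
  apply: integrable_pushforward => //.
  by rewrite preimage_setT; apply: integrable_rdist phiM.
move=> /integrableP[_ intphi]; apply/integrableP; split => //.
rewrite (eq_measure_integral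
  (pushforward_measure (rdist f) mphi))//.
by move=> A mA _ /=; rewrite -[in LHS]phif; exact: rdist_comp.
Qed.

Lemma calR_fin_num f : bounded_continuous f -> calR mu f \is a fin_num.
Proof.
by move=> bf; apply: integrable_fin_num => //; exact: integrable_rdist_id.
Qed.

(** Additivity of the tails on disjointly supported functions. The tail of the
    zero function compensates for c < 0, where [f > c] is the whole space; for
    c >= 0 it vanishes, and [f + g > c] is the disjoint union of [f > c] and
    [g > c]. *)
Lemma mu_gt_add_disjoint f g (c : R) : continuous f -> continuous g ->
  (forall x, f x * g x = 0) -> (forall x, 0 <= f x) ->
  (mu ((f \+ g)%R @^-1` `]c, +oo[) + mu ((cst 0%R : X -> R) @^-1` `]c, +oo[) =
   mu (f @^-1` `]c, +oo[) + mu (g @^-1` `]c, +oo[))%E.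
Proof.
move=> cf cg fg0 f0.
have zero x : f x = 0 \/ g x = 0.
  by have /eqP := fg0 x; rewrite mulf_eq0 => /orP[/eqP|/eqP]; [left|right].
have [c0|c0] := ltP c 0.
  have -> : f @^-1` `]c, +oo[ = setT.
    by apply/seteqP; split=> // x _ /=; rewrite in_itv/= andbT (lt_le_trans c0).
  have -> : (cst 0 : X -> R) @^-1` `]c, +oo[ = setT.
    by apply/seteqP; split=> // x _ /=; rewrite in_itv/= andbT.
  have -> : (f \+ g) @^-1` `]c, +oo[ = g @^-1` `]c, +oo[.
    apply/seteqP; split=> x /=; rewrite !in_itv/= !andbT;
    by have [->|gx0] := zero x; rewrite ?add0r// gx0 addr0 ?c0//;
      rewrite (lt_le_trans c0).
  by rewrite addeC.
have -> : (cst 0 : X -> R) @^-1` `]c, +oo[ = set0.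
  by apply/seteqP; split=> // x /=; rewrite in_itv/= andbT ltNge c0.
rewrite dtm_set0 adde0 -dtm_openU; [|exact: open_gt|exact: open_gt|].
  congr mu; apply/seteqP; split=> x /=; rewrite !in_itv/= !andbT.
    by have [->|->] := zero x; rewrite ?add0r ?addr0; [right|left].
  by have [->|->] := zero x; rewrite ?add0r ?addr0 => -[] //;
    rewrite ltNge c0.
apply/seteqP; split=> // x [] /=; rewrite !in_itv/= !andbT.
move=> cfx cgx; case: (zero x) => e; [move: cfx|move: cgx];
  by rewrite e ltNge c0.
Qed.

Lemma bounded_continuousD f g : bounded_continuous f -> bounded_continuous g ->
  bounded_continuous (f \+ g).
Proof.
move=> [cf [M fM]] [cg [N gN]]; split.
  by move=> x; apply: cvgD; [exact: cf|exact: cg].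
by exists (M + N) => x /=; rewrite (le_trans (ler_normD _ _))// lerD.
Qed.

Lemma bounded_continuousM f a : bounded_continuous f ->
  bounded_continuous (a \*o f).
Proof.
move=> [cf [M fM]]; split.
  by move=> x; apply: cvgM; [exact: cvg_cst|exact: cf].
by exists (`|a| * M) => x /=; rewrite normrM ler_wpM2l.
Qed.

Lemma bounded_continuous_cst (c : R) : bounded_continuous (cst c).
Proof. by split; [exact: cst_continuous|exists `|c|]. Qed.

Lemma calR_cst0 : calR mu (cst 0) = 0%E.
Proof.
have b0 := bounded_continuous_cst 0.
have -> : cst 0 = (cst 0 : R -> R) \o (cst 0 : X -> R) by [].
rewrite (calR_comp _ _ 0)//; first by rewrite integral0.
  exact: cst_continuous.
by move=> t; rewrite normr0.
Qed.

(** The distributions satisfy r(f + g) + r(0) = r(f) + r(g), because their tails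
    do, and the functional is 0 at the zero function. *)
Lemma calR_add_disjoint f g : bounded_continuous f -> bounded_continuous g ->
  (forall x, f x * g x = 0) -> (forall x, 0 <= f x) ->
  calR mu (f \+ g) = (calR mu f + calR mu g)%E.
Proof.
move=> bf bg fg0 f0; have b0 := bounded_continuous_cst 0.
have bfg := bounded_continuousD _ _ bf bg.
have mid : measurable_fun setT (fun t : measurableTypeR R => t%:E).
  exact/measurable_EFinP/measurable_id.
rewrite -[LHS]adde0 -calR_cst0 /calR -!/(rdist _).
rewrite -!integral_measure_add//; try exact: integrable_rdist_id.
apply: eq_measure_integral => A mA _.
have tailD h k c : bounded_continuous h -> bounded_continuous k ->
    measure_add (rdist h) (rdist k) `]c, +oo[%classic =
    (mu (h @^-1` `]c, +oo[) + mu (k @^-1` `]c, +oo[))%E.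
  by move=> bh bk; rewrite measure_addE !rdist_tail.
apply: eq_measure_tails => // c.
  apply: (etrans (tailD _ _ c bfg b0)); rewrite mu_gt_add_disjoint//;
    [|by case: bf|by case: bg].
  exact/esym/tailD.
apply: (@eq_ind_r _ _ (fun z : \bar R => (z < +oo)%E) _ _ (tailD _ _ c bfg b0)).
have fin h : bounded_continuous h -> (mu (h @^-1` `]c, +oo[) < +oo)%E.
  move=> [ch _]; apply: le_lt_trans finmu.
  by apply: le_mu_open => //; [exact: open_gt|exact: openT].
by apply: lte_add_pinfty; exact: fin.
Qed.

(** * Additivity of calR on a cone *)

Lemma C0_bounded_continuous f : C0 f -> bounded_continuous f.
Proof.
move=> [cf f0]; split=> //.
have cA := f0 1 ltr01; set A := [set x | _] in cA.
have [A0|/set0P A0] := eqVneq A set0.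
  exists 1 => x; rewrite leNgt; apply/negP => fx.
  by have : A x by [exact: ltW]; rewrite A0.
have cnf : continuous (fun x => `|f x|).
  by move=> x; apply: continuous_comp; [exact: cf|exact: norm_continuous].
have [y /set_mem Ay ymax] := compact_EVT_max A0 cA (continuous_subspaceT cnf).
exists `|f y| => x; have [fx|fx] := leP 1 `|f x|.
  by apply: ymax; exact: mem_set.
exact: le_trans (ltW fx) Ay.
Qed.

Lemma C0_cst0 : C0 (cst 0 : X -> R).
Proof.
split; first exact: cst_continuous.
move=> e e0; rewrite (_ : [set _ | _] = set0); first exact: compact0.
by apply/seteqP; split=> // x /=; rewrite normr0 leNgt e0.
Qed.

(** By connectedness the closure of the range of f is a compact interval
    [a, b], so that clamp a b maps the line into it and phi \o clamp a b is the
    extension. *)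
Lemma extend_from_closure_range f (phi : R -> R) :
  connected [set: X] -> bounded_continuous f ->
  {within closure (range f), continuous phi} ->
  {in closure (range f) &, {homo phi : x y / x <= y}} ->
  exists2 psi : R -> R, [/\ continuous psi, {homo psi : x y / x <= y}
    & exists M, forall t, `|psi t| <= M] & psi \o f = phi \o f.
Proof.
move=> cX [cf [M fM]] cphi ndphi; set K := closure (range f) in cphi ndphi.
have [[x0 _]|X0] := pselect ([set: X] !=set0); last first.
  exists (cst 0).
    by split; [exact: cst_continuous|by []|exists 0 => t; rewrite normr0].
  by apply/funext => x; exfalso; apply: X0; exists x.
have range0 : range f !=set0 by exists (f x0), x0.
have hub : has_ubound (range f).
  by exists M => _ [x _ <-]; exact: le_trans (ler_norm _) (fM x).
have hlb : has_lbound (range f).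
  by exists (- M) => _ [x _ <-]; have := fM x; rewrite ler_norml => /andP[].
pose a := inf (range f); pose b := sup (range f).
have fab x : a <= f x <= b.
  by apply/andP; split; [apply: ge_inf|apply: ub_le_sup] => //; exists x.
have ab : a <= b by have /andP[] := fab x0; exact: le_trans.
have KE t : a <= t <= b -> K t.
  have /connected_intervalP itv : connected (range f).
    by apply: connected_continuous_connected => //; exact: continuous_subspaceT.
  rewrite le_eqVlt => /andP[/predU1P[<- _|at_]]; first exact: closure_inf.
  rewrite le_eqVlt => /predU1P[->|tb]; first exact: closure_sup.
  have [u ru ut] := inf_lt range0 at_.
  have [v rv tv] := sup_gt range0 tb.
  by apply: subset_closure; apply: (itv _ _ ru rv); rewrite (ltW ut) (ltW tv).
pose psi := phi \o clamp a b.
have Kclamp t : K (clamp a b t) by apply/KE/clamp_bounds.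
have ndpsi : {homo psi : x y / x <= y}.
  by move=> x y xy; apply: ndphi; rewrite ?inE//; exact: clamp_nondecreasing.
exists psi; last by apply/funext => x /=; rewrite /psi/= clamp_id.
split=> //.
  move=> t; have /subspace_continuousP/(_ _ (Kclamp t)) cphit := cphi.
  apply: (cvg_comp _ _ _ cphit) => P /= wP.
  have : \forall s \near t, K (clamp a b s) -> P (clamp a b s).
    exact: (clamp_continuous a b t _ wP).
  by apply: filterS => s; apply; exact: Kclamp.
exists (`|phi a| + `|phi b|) => t.
have pa : phi a <= psi t.
  by apply: ndphi; rewrite ?inE//; [apply: KE; rewrite lexx|
     case/andP: (clamp_bounds a b t ab)].
have pb : psi t <= phi b.
  by apply: ndphi; rewrite ?inE//; [apply: KE; rewrite lexx andbT|
     case/andP: (clamp_bounds a b t ab)].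
rewrite ler_norml; have := ler_norm (phi b); have := ler_norm (- phi a).
rewrite normrN; have := normr_ge0 (phi a); have := normr_ge0 (phi b).
by move=> *; apply/andP; split; lra.
Qed.

(** Both functions are of the form psi \o f, so that both values are integrals
    against the one measure r(f): the claim is the linearity of the integral. *)
Lemma calR_Aplus f g h (a b : R) : connected [set: X] ->
  bounded_continuous f -> Aplus f g -> Aplus f h -> 0 <= a -> 0 <= b ->
  calR mu ((a \*o g) \+ (b \*o h)) = (a%:E * calR mu g + b%:E * calR mu h)%E.
Proof.
move=> cX bf [phi [cphi ndphi _ ->]] [psi [cpsi ndpsi _ ->]] a0 b0.
have [p [cp ndp [M pM]] <-] := extend_from_closure_range f phi cX bf cphi ndphi.
have [q [cq ndq [N qN]] <-] := extend_from_closure_range f psi cX bf cpsi ndpsi.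
pose r := (fun t => a * p t + b * q t) : R -> R.
have -> : (a \*o (p \o f)) \+ (b \*o (q \o f)) = r \o f by [].
have cr : continuous r.
  by move=> t; apply: cvgD; apply: cvgM; [exact: cvg_cst|exact: cp|
     exact: cvg_cst|exact: cq].
have ndr : {homo r : x y / x <= y}.
  move=> x y xy.
  by apply: lerD; apply: ler_wpM2l => //; [exact: ndp|exact: ndq].
rewrite (calR_comp f r (a * M + b * N))//; last first.
  move=> t; rewrite (le_trans (ler_normD _ _))// !normrM.
  rewrite (ger0_norm a0) (ger0_norm b0).
  by rewrite lerD// ler_wpM2l.
rewrite (calR_comp f p M)// (calR_comp f q N)//.
have ip := integrable_rdist f p M bf cp pM.
have iq := integrable_rdist f q N bf cq qN.
rewrite -!integralZl//.
rewrite -(integralD measurableT (integrableZl measurableT a ip)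
  (integrableZl measurableT b iq)).
by apply: eq_integral => t _; rewrite EFinD !EFinM.
Qed.

Lemma Aplus_refl f : Aplus f f.
Proof.
by exists id; split=> //; apply: continuous_subspaceT => x; exact: cvg_id.
Qed.

Lemma Aplus_cst f c : compact [set: X] -> Aplus f (cst c).
Proof.
move=> cX; exists (cst c); split=> //.
by apply: continuous_subspaceT; exact: cst_continuous.
Qed.

(** * Reduction of calL to calR *)

Lemma Aminus_opp f g : Aminus f g -> Aplus f (\- g).
Proof.
move=> [phi [cphi niphi phi0 ->]]; exists (\- phi); split=> //.
- by move=> x; apply: cvgN; exact: cphi.
- by move=> x y xK yK xy; rewrite lerN2 niphi.
- by move=> /phi0 /= ->; rewrite oppr0.
Qed.

(** [f < c] is [- f > - c], so l(f) is the image of r(- f) under t |-> - t; the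
    open rays match, which is what the tails compare. *)
Lemma calL_opp f : bounded_continuous f -> calL mu f = (- calR mu (\- f)%R)%E.
Proof.
move=> bf; have bNf := bounded_continuousN _ bf.
have cN : continuous (-%R : R -> R) by exact: opp_continuous.
have mN := continuous_measurableTypeR _ cN.
rewrite /calR -/(rdist (\- f)) /calL -/(ldist f).
have E A : measurable A -> rdist (\- f) A =
    pushforward (T2 := measurableTypeR R) (ldist f) -%R A.
  move=> mA; apply: (eq_measure_tails _ (rdist (\- f))
    (pushforward_measure (ldist f) mN)) => //= c; last first.
    apply: le_lt_trans (rdist_setT_lty _ bNf).
    by apply: le_measure; rewrite ?inE.
  rewrite rdist_tail// /pushforward.
  have -> : -%R @^-1` `]c, +oo[ = `]-oo, (- c)[%classic.
    by apply/seteqP; split=> x /=; rewrite !in_itv/= andbT ltrNr.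
  rewrite ldist_tail//; congr mu; apply/seteqP; split=> x /=.
    by rewrite !in_itv/= andbT ltrNr.
  by rewrite !in_itv/= andbT ltrNr.
have mNset A : measurable A ->
    measurable ((-%R : measurableTypeR R -> measurableTypeR R) @^-1` A).
  by move=> mA; rewrite -[X in measurable X]setTI; exact: mN.
have irN : (rdist (\- f)).-integrable setT
    (fun t : measurableTypeR R => - t%:E)%E.
  by apply: integrableN => //; exact: integrable_rdist_id.
rewrite (eq_measure_integral
  (pushforward_measure (rdist (\- f)) mN)); last first.
  move=> A mA _; apply: (@esym _ _ (ldist f A)).
  rewrite [LHS](E _ (mNset _ mA)) /pushforward -comp_preimage.
  congr (ldist f _).
  by apply/seteqP; split=> x /=; rewrite opprK.
rewrite integral_pushforward//.
rewrite preimage_setT -integralN.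
  by apply: eq_integral => t _.
exact: integrable_add_def (integrable_rdist_id _ bNf).
Qed.

Lemma calR_C0_functional : C0_functional (calR mu).
Proof.
have fin f : C0 f -> calR mu f \is a fin_num.
  by move=> /C0_bounded_continuous; exact: calR_fin_num.
split; last by rewrite calR_cst0 abse0.
by left=> f /fin; rewrite fin_numE => /andP[].
Qed.

Lemma calL_C0_functional : C0_functional (calL mu).
Proof.
have fin f : C0 f -> calL mu f \is a fin_num.
  move=> /C0_bounded_continuous bf; rewrite calL_opp// fin_numN.
  exact/calR_fin_num/bounded_continuousN.
split; last by rewrite -fin_num_abs; exact/fin/C0_cst0.
by left=> f /fin; rewrite fin_numE => /andP[].
Qed.

Lemma calL_add_disjoint f g : bounded_continuous f -> bounded_continuous g ->
  (forall x, f x * g x = 0) ->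
  (forall x, f x <= 0) \/ (forall x, g x <= 0) ->
  calL mu (f \+ g) = (calL mu f + calL mu g)%E.
Proof.
move=> bf bg fg0 fg.
wlog f0 : f g bf bg fg0 fg / forall x, f x <= 0.
  move=> wl; have [f0|g0] := fg; first exact: wl.
  have -> : f \+ g = g \+ f by apply/funext => x /=; rewrite addrC.
  by rewrite addeC; apply: wl => // [x|]; [rewrite mulrC|left].
have bNf := bounded_continuousN _ bf; have bNg := bounded_continuousN _ bg.
rewrite !calL_opp//; last exact: bounded_continuousD.
have -> : \- (f \+ g) = (\- f) \+ (\- g).
  by apply/funext => x /=; rewrite opprD.
rewrite calR_add_disjoint// => [|x|x]; last 2 first.
- by rewrite mulrNN.
- by rewrite oppr_ge0.
by rewrite fin_num_oppeD// calR_fin_num.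
Qed.

Lemma le_calL f g : bounded_continuous f -> bounded_continuous g ->
  (forall x, f x <= g x) -> (forall x, g x <= 0) -> (calL mu f <= calL mu g)%E.
Proof.
move=> bf bg fg g0; rewrite !calL_opp// leeN2; apply: le_calR => [||x|x].
- exact: bounded_continuousN.
- exact: bounded_continuousN.
- by rewrite oppr_ge0.
- by rewrite lerN2.
Qed.

Lemma Aplus_bounded_continuous f g : connected [set: X] ->
  bounded_continuous f -> Aplus f g -> bounded_continuous g.
Proof.
move=> cX bf [phi [cphi ndphi _ ->]].
have [p [cp ndp _] <-] := extend_from_closure_range f phi cX bf cphi ndphi.
exact: bounded_continuous_comp.
Qed.

Lemma calL_Aminus f g h (a b : R) : connected [set: X] ->
  bounded_continuous f -> Aminus f g -> Aminus f h -> 0 <= a -> 0 <= b ->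
  calL mu ((a \*o g) \+ (b \*o h)) = (a%:E * calL mu g + b%:E * calL mu h)%E.
Proof.
move=> cX bf /Aminus_opp fg /Aminus_opp fh a0 b0.
have bNg := Aplus_bounded_continuous _ _ cX bf fg.
have bNh := Aplus_bounded_continuous _ _ cX bf fh.
have oppK (k : X -> R) : \- (\- k) = k by apply/funext => x /=; rewrite opprK.
have bg : bounded_continuous g by rewrite -(oppK g); exact: bounded_continuousN.
have bh : bounded_continuous h by rewrite -(oppK h); exact: bounded_continuousN.
rewrite !calL_opp//; last first.
  by apply: bounded_continuousD; exact: bounded_continuousM.
have -> : \- ((a \*o g) \+ (b \*o h)) = (a \*o (\- g)) \+ (b \*o (\- h)).
  by apply/funext => x /=; rewrite opprD !mulrN.
rewrite (calR_Aplus f)// fin_num_oppeD ?fin_numM ?calR_fin_num//.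
by rewrite !muleN.
Qed.

Lemma Aminus_oppr f : Aminus (\- f) f.
Proof.
exists -%R; split=> //.
- by apply: continuous_subspaceT; exact: opp_continuous.
- by move=> x y _ _ xy; rewrite lerN2.
- by rewrite oppr0.
- by apply/funext => x /=; rewrite opprK.
Qed.

Lemma Aminus_cst f c : compact [set: X] -> Aminus f (cst c).
Proof.
move=> cX; exists (cst c); split=> //.
by apply: continuous_subspaceT; exact: cst_continuous.
Qed.

End dtm.

(** * The conic quasi-linear and the l- and r-functional properties *)

Lemma calR_p_conic (R : realType) (X : topologicalType)
    (mu : set X -> \bar R) : deficient_topological_measure mu ->
  (mu [set: X] < +oo)%E -> connected [set: X] ->
  p_conic_quasi_linear (calR mu).
Proof.
move=> dmu finmu cX; split; first exact: calR_C0_functional.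
- move=> f g /C0_bounded_continuous bf /C0_bounded_continuous bg fg0 f0 _.
  by apply: calR_add_disjoint => // x; have := congr1 (@^~ x) fg0.
- move=> f g /C0_bounded_continuous bf /C0_bounded_continuous bg g0 gf.
  exact: le_calR.
- move=> f /C0_bounded_continuous bf g h fg fh a b a0 b0.
  exact: calR_Aplus fg fh a0 b0.
Qed.

(** Homogeneity and translation by constants are instances of additivity on the
    cone of f, which contains f and, over a compact space, the constants. *)
Lemma calR_r_functional (R : realType) (X : topologicalType)
    (mu : set X -> \bar R) : deficient_topological_measure mu ->
  (mu [set: X] < +oo)%E -> connected [set: X] ->
  r_functional (calR mu).
Proof.
move=> dmu finmu cX; split; first exact: calR_C0_functional.
- move=> f /C0_bounded_continuous bf a a0.
  have -> : a \*o f = (a \*o f) \+ (0 \*o f).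
    by apply/funext => x /=; rewrite mul0r addr0.
  have ff := Aplus_refl _ _ f.
  by rewrite (calR_Aplus _ _ _ dmu finmu _ _ _ a 0 cX bf ff ff (ltW a0))//
    mul0e adde0.
- move=> f g /C0_bounded_continuous bf /C0_bounded_continuous bg g0 gf.
  exact: le_calR.
- move=> f g /C0_bounded_continuous bf /C0_bounded_continuous bg fg0 fg.
  apply: calR_add_disjoint => //; first by move=> x; have := congr1 (@^~ x) fg0.
  by case: fg => -[].
- move=> compX f /C0_bounded_continuous bf c.
  have -> : f \+ cst c = (1 \*o f) \+ (1 \*o cst c).
    by apply/funext => x /=; rewrite !mul1r.
  have ff := Aplus_refl _ _ f; have fc := Aplus_cst _ _ f c compX.
  by rewrite (calR_Aplus _ _ _ dmu finmu _ _ _ 1 1 cX bf ff fc)// !mul1e.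
Qed.

Lemma calL_n_conic (R : realType) (X : topologicalType)
    (mu : set X -> \bar R) : deficient_topological_measure mu ->
  (mu [set: X] < +oo)%E -> connected [set: X] ->
  n_conic_quasi_linear (calL mu).
Proof.
move=> dmu finmu cX; split; first exact: calL_C0_functional.
- move=> f g /C0_bounded_continuous bf /C0_bounded_continuous bg fg0 f0 _.
  apply: calL_add_disjoint => // [x|]; first by have := congr1 (@^~ x) fg0.
  by left.
- move=> f g /C0_bounded_continuous bf /C0_bounded_continuous bg fg g0.
  exact: le_calL.
- move=> f /C0_bounded_continuous bf g h fg fh a b a0 b0.
  exact: calL_Aminus fg fh a0 b0.
Qed.

(** The cone used here is that of - f, which contains f because the functions
    phi are now non-increasing. *)
Lemma calL_l_functional (R : realType) (X : topologicalType)
    (mu : set X -> \bar R) : deficient_topological_measure mu ->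
  (mu [set: X] < +oo)%E -> connected [set: X] ->
  l_functional (calL mu).
Proof.
move=> dmu finmu cX; split; first exact: calL_C0_functional.
- move=> f /C0_bounded_continuous bf a a0.
  have -> : a \*o f = (a \*o f) \+ (0 \*o f).
    by apply/funext => x /=; rewrite mul0r addr0.
  have bNf := bounded_continuousN _ _ _ bf; have ff := Aminus_oppr _ _ f.
  by rewrite (calL_Aminus _ _ _ dmu finmu _ _ _ a 0 cX bNf ff ff (ltW a0))//
    mul0e adde0.
- move=> f g /C0_bounded_continuous bf /C0_bounded_continuous bg gf f0.
  exact: le_calL.
- move=> f g /C0_bounded_continuous bf /C0_bounded_continuous bg fg0 fg.
  apply: calL_add_disjoint => // [x|]; first by have := congr1 (@^~ x) fg0.
  by case: fg => -[? ?]; [left|right].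
- move=> compX f /C0_bounded_continuous bf c.
  have -> : f \+ cst c = (1 \*o f) \+ (1 \*o cst c).
    by apply/funext => x /=; rewrite !mul1r.
  have bNf := bounded_continuousN _ _ _ bf; have ff := Aminus_oppr _ _ f.
  have fc := Aminus_cst _ _ (\- f) c compX.
  by rewrite (calL_Aminus _ _ _ dmu finmu _ _ _ 1 1 cX bNf ff fc)// !mul1e.
Qed.

Theorem theorem7p10 (R : realType) (X : topologicalType)
    (lcX : locally_compact [set: X]) (hX : hausdorff_space X)
    (cX : connected [set: X])
    (mu : set X -> \bar R) (dmu : deficient_topological_measure mu)
    (finmu : (mu [set: X] < +oo)%E) :
  (p_conic_quasi_linear (calR mu) /\ n_conic_quasi_linear (calL mu)) /\
  (r_functional (calR mu) /\ l_functional (calL mu)).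
Proof.
split; split.
- exact: calR_p_conic.
- exact: calL_n_conic.
- exact: calR_r_functional.
- exact: calL_l_functional.
Qed.
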